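(* Let $(D_d)_{d\in\mathbb{N}}$ satisfy Property (P). Let $(L_d)_{d\in\mathbb N}$ be positive numbers and \[ C_d^0(L)=\{f\colon D_d\to\mathbb{R} \mid \|f\|_\infty\le 1,\ \operatorname{Lip}(f)\le L_d\}. \] Then the curse of dimensionality holds for the integration problem on $(C_d^0(L))_{d}$ if and only if $\limsup_{d\to\infty} L_d\sqrt{d}>0$.
   Context: Property (P): $(D_d)_{d\in\mathbb{N}}$ is a sequence of open sets $D_d\subset\mathbb{R}^d$ with Lebesgue measure $\lambda_d(D_d)=1$ for which there exist points $x_d^*\in D_d$ and $R<\infty$ with $\lim_{d\to\infty}\lambda_d(\{x\in D_d\mid \|x-x_d^*\|_2\ge R\sqrt d\})=0$. $\operatorname{Lip}(f)=\sup_{x\neq y}|f(x)-f(y)|/\|x-y\|_2$ and $\|f\|_\infty=\sup_{x\in D_d}|f(x)|$. Integration problem: approximate $S_d(f)=\int_{D_d}f(x)\,dx$ for $f\in F_d$ by algorithms $A_{n,d}(f)=\phi_{n,d}(f(x_1),\dots,f(x_n))$ with points $x_j\in D_d$ possibly chosen adaptively (depending on previously computed values) and arbitrary $\phi_{n,d}\colon\mathbb{R}^n\to\mathbb{R}$ (for $n=0$, constant algorithms). The worst-case error is $e(A_{n,d})=\sup_{f\in F_d}|S_d(f)-A_{n,d}(f)|$, and the information complexity $n(\varepsilon,F_d)$ is the minimal $n$ for which some such $A_{n,d}$ has $e(A_{n,d})\le\varepsilon$. The curse of dimensionality holds for $(F_d)$ if there exist $c,\varepsilon_0,\gamma>0$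 with $n(\varepsilon,F_d)\ge c(1+\gamma)^d$ for all $\varepsilon\le\varepsilon_0$ and infinitely many $d\in\mathbb{N}$. *)

(* Defs.v *)
From HB Require Import structures.
From mathcomp Require Import all_boot all_order all_algebra.
From mathcomp Require Import all_classical all_reals all_analysis.
Set Implicit Arguments. Unset Strict Implicit. Unset Printing Implicit Defensive.
Import Order.TTheory GRing.Theory Num.Theory.
Import numFieldNormedType.Exports.
Local Open Scope classical_set_scope.
Local Open Scope ring_scope.

Section Defs.
Variable R : realType.

Definition norm2 (d : nat) (x : d.-tuple R) : R :=
  Num.sqrt (\sum_(i < d) (tnth x i) ^+ 2).

Definition dist2 (d : nat) (x y : d.-tuple R) : R :=
  Num.sqrt (\sum_(i < d) (tnth x i - tnth y i) ^+ 2).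

Definition open_Rd (d : nat) (D : set (d.-tuple R)) : Prop :=
  forall x, D x -> exists2 e : R, 0 < e & forall y, dist2 x y < e -> D y.

(* Iterated Lebesgue integral over R^d (coordinate by coordinate; by Tonelli
   this is the d-dimensional Lebesgue integral of nonnegative measurable
   functions). *)
Fixpoint iint (d : nat) : (d.-tuple R -> \bar R) -> \bar R :=
  match d return (d.-tuple R -> \bar R) -> \bar R with
  | 0 => fun g => g [tuple]
  | m.+1 => fun g =>
      (\int[@lebesgue_measure R]_x iint (fun t : m.-tuple R => g [tuple of x :: t]))%E
  end.

Definition lebesgue_d (d : nat) (A : set (d.-tuple R)) : \bar R :=
  iint (fun t => (\1_A t)%:E).

Definition integral_on (d : nat) (D : set (d.-tuple R)) (f : d.-tuple R -> R)
  : \bar R :=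
  (iint (fun t => (\1_D t * Num.max (f t) 0)%:E)
   - iint (fun t => (\1_D t * Num.max (- f t) 0)%:E))%E.

Definition property_P (D : forall d : nat, set (d.-tuple R)) : Prop :=
  (forall d, open_Rd (D d)) /\
  (forall d, lebesgue_d (D d) = 1%E) /\
  exists xs : forall d : nat, d.-tuple R, exists Rad : R,
    (forall d, D d (xs d)) /\
    (fun d => lebesgue_d
       [set x | D d x /\ Rad * Num.sqrt d%:R <= dist2 x (xs d)]) @ \oo --> 0%E.

Definition C0 (d : nat) (D : set (d.-tuple R)) (L : R) : set (d.-tuple R -> R) :=
  [set f | (forall x, D x -> `|f x| <= 1) /\
           (forall x y, D x -> D y -> `|f x - f y| <= L * dist2 x y)].

(* Adaptive deterministic algorithms using n function values:
   x_{j+1} = pt j (f x_1, ..., f x_j), A(f) = phi (f x_1, ..., f x_n). *)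
Record algorithm (d : nat) := Algorithm {
  nvals : nat;
  pt : nat -> seq R -> d.-tuple R;
  phi : seq R -> R }.

Fixpoint info (d : nat) (p : nat -> seq R -> d.-tuple R) (f : d.-tuple R -> R)
  (k : nat) : seq R :=
  match k with
  | 0 => [::]
  | k'.+1 => let s := info p f k' in rcons s (f (p k' s))
  end.

Definition run (d : nat) (A : algorithm d) (f : d.-tuple R -> R) : R :=
  phi A (info (pt A) f (nvals A)).

Definition alg_in (d : nat) (D : set (d.-tuple R)) (A : algorithm d) : Prop :=
  forall j s, D (pt A j s).

Definition wc_error (d : nat) (D : set (d.-tuple R)) (F : set (d.-tuple R -> R))
  (A : algorithm d) : \bar R :=
  ereal_sup [set (`|integral_on D f - (run A f)%:E|)%E | f in F].

(* information complexity n(eps, F_d) (= +oo if no algorithm achieves eps) *)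
Definition info_complexity (d : nat) (D : set (d.-tuple R))
  (F : set (d.-tuple R -> R)) (eps : R) : \bar R :=
  ereal_inf [set ((nvals A)%:R)%:E | A in
             [set A : algorithm d | alg_in D A /\ (wc_error D F A <= eps%:E)%E]].

Definition curse (D : forall d : nat, set (d.-tuple R))
  (F : forall d : nat, set (d.-tuple R -> R)) : Prop :=
  exists c eps0 gamma : R, [/\ 0 < c, 0 < eps0, 0 < gamma &
    forall N : nat, exists2 d : nat, (N <= d)%N &
      forall eps : R, eps <= eps0 ->
        ((c * (1 + gamma) ^+ d)%:E <= info_complexity (D d) (F d) eps)%E].

End Defs.

(* Main.v *)
(** The case of small Lipschitz constants: if [L d * sqrt d] tends to 0, then all
    but a vanishing part of [D d] lies within distance [Rad * sqrt d] of [xs d],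
    where [f] differs from [f (xs d)] by at most [L d * Rad * sqrt d]. A single
    function value then solves the problem for large [d].

    The case of large Lipschitz constants: let [L d * sqrt d >= delta]. The minimum
    of 1 and [L d] times the distance to the [n] points that the algorithm queries
    on the zero function is indistinguishable from its opposite, so its integral is
    a lower bound for the error. Outside the balls of radius [r * sqrt d] around
    these points it is at least [min(1, delta * r)], and for small [r] each ball has
    volume at most [2^-d], so [n] has to be of order [2^d]. *)
Require Import Defs.
From HB Require Import structures.
From mathcomp Require Import all_boot all_order all_algebra.
From mathcomp Require Import all_classical all_reals all_analysis.
From mathcomp Require Import measurable_realfun ring lra.
Import Order.TTheory GRing.Theory Num.Theory.
Import numFieldNormedType.Exports.
Local Open Scope classical_set_scope.
Local Open Scope ring_scope.
Set Implicit Arguments. Unset Strict Implicit.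

(** * Iterated Lebesgue integrals of nonnegative measurable functions *)

Section IteratedIntegral.
Context {R : realType}.
Implicit Types d : nat.

Lemma iint_ge0 d (g : d.-tuple R -> \bar R) :
  (forall t, 0 <= g t)%E -> (0 <= iint g)%E.
Proof.
elim: d g => [|d IH] g g0 /=; first exact: g0.
by apply: integral_ge0 => x _; apply: IH.
Qed.

(** The parameter space [T] is arbitrary so that the induction can move the first coordinate into
    it, replacing [T] by [T * R]; Tonelli then gives measurability of the remaining one-dimensional
    integral. *)
Lemma measurable_iint d (dT : measure_display) (T : measurableType dT)
    (g : T * d.-tuple R -> \bar R) :
  measurable_fun setT g -> (forall z, 0 <= g z)%E ->
  measurable_fun setT (fun x => iint (fun t => g (x, t))).
Proof.
elim: d dT T g => [|d IH] dT T g mg g0 /=.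
  exact: measurableT_comp mg (measurable_pair2 _).
pose h (z : (T * R) * d.-tuple R) := g (z.1.1, [tuple of z.1.2 :: z.2]).
have mh : measurable_fun setT h.
  apply: measurableT_comp mg _.
  apply: measurable_fun_pair; first exact: measurableT_comp.
  by apply: measurable_cons => //; exact: measurableT_comp.
have := IH _ _ h mh (fun z => g0 _).
move=> /(measurable_fun_fubini_tonelli_F (m2 := @lebesgue_measure R)).
by apply=> z; apply: iint_ge0 => t; exact: g0.
Qed.

Lemma measurable_iint_cons d (g : d.+1.-tuple R -> \bar R) :
  measurable_fun setT g -> (forall t, 0 <= g t)%E ->
  measurable_fun setT (fun x : R => iint (fun t => g [tuple of x :: t])).
Proof.
move=> mg g0.
apply: (@measurable_iint d _ _
  (fun z : R * d.-tuple R => g [tuple of z.1 :: z.2])) => //.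
by apply: measurableT_comp mg _; exact: measurable_cons.
Qed.

Lemma measurable_cons1 d (g : d.+1.-tuple R -> \bar R) (x : R) :
  measurable_fun setT g ->
  measurable_fun setT (fun t : d.-tuple R => g [tuple of x :: t]).
Proof. by move=> mg; apply: measurableT_comp mg _; exact: measurable_cons. Qed.

Lemma le_iint d (g h : d.-tuple R -> \bar R) :
  measurable_fun setT g -> measurable_fun setT h ->
  (forall t, 0 <= g t)%E -> (forall t, g t <= h t)%E -> (iint g <= iint h)%E.
Proof.
elim: d g h => [|d IH] g h mg mh g0 gh /=; first exact: gh.
have h0 t : (0 <= h t)%E by exact: le_trans (gh t).
apply: ge0_le_integral => //.
- by move=> x _; exact: iint_ge0.
- exact: measurable_iint_cons.
- exact: measurable_iint_cons.
- by move=> x _; apply: IH => //; exact: measurable_cons1.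
Qed.

Lemma iintD d (g h : d.-tuple R -> \bar R) :
  measurable_fun setT g -> measurable_fun setT h ->
  (forall t, 0 <= g t)%E -> (forall t, 0 <= h t)%E ->
  iint (fun t => g t + h t)%E = (iint g + iint h)%E.
Proof.
elim: d g h => [//|d IH] g h mg mh g0 h0 /=.
under eq_integral.
  move=> x _; rewrite IH //; [|exact: measurable_cons1|exact: measurable_cons1].
  over.
rewrite ge0_integralD//.
- by move=> x _; exact: iint_ge0.
- exact: measurable_iint_cons.
- by move=> x _; exact: iint_ge0.
- exact: measurable_iint_cons.
Qed.

Lemma iintZl d (k : R) (g : d.-tuple R -> \bar R) :
  measurable_fun setT g -> (forall t, 0 <= g t)%E -> 0 <= k ->
  iint (fun t => k%:E * g t)%E = (k%:E * iint g)%E.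
Proof.
move=> + + k0; elim: d g => [//|d IH] g mg g0 /=.
under eq_integral.
  move=> x _; rewrite IH //; last exact: measurable_cons1.
  over.
rewrite ge0_integralZl_EFin//; first by move=> x _; exact: iint_ge0.
exact: measurable_iint_cons.
Qed.

Lemma iint0 d : iint (fun _ : d.-tuple R => 0%:E) = 0%E.
Proof.
have := @iintZl d 0 (cst 0%E) (measurable_cst _) (fun=> lexx _) (lexx _).
by rewrite mul0e; under eq_fun do rewrite mul0e.
Qed.

Lemma iint_sum d (I : Type) (s : seq I) (g : I -> d.-tuple R -> R) :
  (forall i, measurable_fun setT (g i)) -> (forall i t, 0 <= g i t) ->
  iint (fun t => (\sum_(i <- s) g i t)%:E) =
  (\sum_(i <- s) iint (EFin \o g i))%E.
Proof.
move=> mg g0; elim: s => [|i s IH].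
  by rewrite big_nil; under eq_fun do rewrite big_nil; exact: iint0.
rewrite big_cons -IH -iintD //.
- by under eq_fun do rewrite big_cons EFinD.
- by apply/measurable_EFinP; exact: mg.
- apply/measurable_EFinP; exact: measurable_sum.
- by move=> t; rewrite lee_fin /=; exact: g0.
- by move=> t; rewrite lee_fin; apply: sumr_ge0 => j _.
Qed.

(** In each integration the factors of the other coordinates are constants that can be pulled out.
    This evaluates the Gaussian product in [ball_volume]. *)
Lemma iint_prod d (g : 'I_d -> R -> R) :
  (forall i, measurable_fun setT (g i)) -> (forall i x, 0 <= g i x) ->
  (iint (fun t => (\prod_(i < d) g i (tnth t i))%:E) =
   \prod_(i < d) \int[lebesgue_measure]_x (g i x)%:E)%E.
Proof.
elim: d g => [|d IH] g mg g0 /=; first by rewrite !big_ord0.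
rewrite big_ord_recl.
under eq_integral.
  move=> x _.
  rewrite (_ : (fun t => _) = (fun t : d.-tuple R => (g ord0 x)%:E *
    (\prod_(i < d) g (lift ord0 i) (tnth t i))%:E)%E); last first.
    apply/funext => t; rewrite big_ord_recl EFinM tnth0.
    by congr (_ * _%:E)%E; apply: eq_bigr => i _; rewrite tnthS.
  rewrite iintZl//; last 2 first.
  - apply/measurable_EFinP; apply: measurable_prod => i _.
    exact: measurableT_comp (mg _) (measurable_tnth _).
  - by move=> t; rewrite lee_fin prodr_ge0.
  rewrite (IH (fun i => g (lift ord0 i)))//.
  over.
rewrite ge0_integralZr//.
- by apply/measurable_EFinP; exact: mg.
- by move=> x _; rewrite lee_fin.
- by apply: prode_ge0 => i _; apply: integral_ge0 => x _; rewrite lee_fin.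
Qed.

End IteratedIntegral.

(** * Euclidean distance, and measurability derived from openness *)

Section EuclideanDistance.
Context {R : realType} {d : nat}.
Implicit Types x y z : d.-tuple R.

Lemma dist2_ge0 x y : 0 <= dist2 x y.
Proof. exact: sqrtr_ge0. Qed.

Lemma sqr_dist2 x y : dist2 x y ^+ 2 = \sum_(i < d) (tnth x i - tnth y i) ^+ 2.
Proof. by rewrite sqr_sqrtr// sumr_ge0// => i _; exact: sqr_ge0. Qed.

Lemma dist2C x y : dist2 x y = dist2 y x.
Proof.
by congr Num.sqrt; apply: eq_bigr => i _; rewrite -sqrrN opprB.
Qed.

Lemma dist2xx x : dist2 x x = 0.
Proof.
by rewrite /dist2 big1 ?sqrtr0// => i _; rewrite subrr expr0n.
Qed.

(** Sum the weighted inequality [a b <= (B / A) a^2 / 2 + (A / B) b^2 / 2], whose right side adds up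
    to [A * B]; if [A] or [B] is 0, all products vanish. *)
Lemma cauchy_schwarz_sum (a b : 'I_d -> R) (A B : R) :
  0 <= A -> 0 <= B -> A ^+ 2 = \sum_i a i ^+ 2 -> B ^+ 2 = \sum_i b i ^+ 2 ->
  \sum_i a i * b i <= A * B.
Proof.
move=> A0 B0 eA eB.
have null (u : 'I_d -> R) : 0 = \sum_i u i ^+ 2 -> forall i, u i = 0.
  move=> /esym/eqP; rewrite psumr_eq0; last by move=> i _; exact: sqr_ge0.
  by move=> /allP u0 i; apply/eqP; have := u0 i (mem_index_enum _); rewrite sqrf_eq0.
have [A0'|An0] := eqVneq A 0.
  rewrite A0' mul0r big1// => i _; rewrite (null a) ?mul0r//.
  by rewrite -eA A0' expr0n.
have [B0'|Bn0] := eqVneq B 0.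
  rewrite B0' mulr0 big1// => i _; rewrite (null b) ?mulr0//.
  by rewrite -eB B0' expr0n.
have Agt : 0 < A by rewrite lt_def An0.
have Bgt : 0 < B by rewrite lt_def Bn0.
have le i : a i * b i <= (B / A / 2) * a i ^+ 2 + (A / B / 2) * b i ^+ 2.
  rewrite -subr_ge0.
  have -> : B / A / 2 * a i ^+ 2 + A / B / 2 * b i ^+ 2 - a i * b i =
    (B * a i - A * b i) ^+ 2 / (2 * A * B).
    by field; rewrite An0 Bn0.
  by rewrite divr_ge0 ?sqr_ge0// !mulr_ge0.
apply: le_trans (ler_sum _ (fun i _ => le i)) _.
rewrite big_split/= -!mulr_sumr -eA -eB.
by rewrite le_eqVlt; apply/orP; left; apply/eqP; field; rewrite An0 Bn0.
Qed.

Lemma dist2_triangle y x z : dist2 x z <= dist2 x y + dist2 y z.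
Proof.
rewrite -(@ler_pXn2r _ 2) ?nnegrE ?addr_ge0 ?dist2_ge0//.
have cs := @cauchy_schwarz_sum (fun i => tnth x i - tnth y i)
  (fun i => tnth y i - tnth z i) _ _ (dist2_ge0 x y) (dist2_ge0 y z)
  (sqr_dist2 x y) (sqr_dist2 y z).
rewrite sqrrD !sqr_dist2.
rewrite (_ : \sum_i (tnth x i - tnth z i) ^+ 2 =
   \sum_(i < d) (tnth x i - tnth y i) ^+ 2 +
   (\sum_(i < d) (tnth x i - tnth y i) * (tnth y i - tnth z i)) *+ 2 +
   \sum_(i < d) (tnth y i - tnth z i) ^+ 2).
  by rewrite lerD2r lerD2l lerMn2r/=.
rewrite -mulr_natl mulr_sumr -!big_split/=; apply: eq_bigr => i _; ring.
Qed.

(** The divisor [d.+1] is nonzero even in dimension 0 and keeps [d * (e / d.+1)^2 < e^2] strict. *)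
Lemma dist2_lt_coord x y (e : R) : 0 < e ->
  (forall i, `|tnth x i - tnth y i| < e / d.+1%:R) -> dist2 x y < e.
Proof.
move=> e0 xy.
have d0 : (0 : R) < d.+1%:R by rewrite ltr0n.
rewrite -(@ltr_pXn2r _ 2) ?nnegrE ?dist2_ge0 ?(ltW e0)// sqr_dist2.
apply: (@le_lt_trans _ _ (\sum_(i < d) (e / d.+1%:R) ^+ 2)).
  apply: ler_sum => i _; rewrite -real_normK ?num_real//.
  have dl0 : 0 <= e / d.+1%:R by rewrite divr_ge0 ?ltW.
  by rewrite ler_pXn2r ?nnegrE//; exact: ltW (xy i).
rewrite sumr_const card_ord -[ltLHS]mulr_natl expr_div_n mulrCA gtr_pMr ?exprn_gt0//.
rewrite ltr_pdivrMr ?exprn_gt0// mul1r -natrX ltr_nat.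
by rewrite expnS expn1 mulSn ltn_addr.
Qed.

Lemma measurable_dist2 x : measurable_fun setT (dist2 x).
Proof.
apply: measurableT_comp.
  by apply: continuous_measurable_fun; exact: sqrt_continuous.
apply: measurable_sum => i.
apply: measurable_funX; apply: measurable_funB => //.
exact: measurable_tnth.
Qed.

(** An open set is the countable union of those balls with rational centre and radius [1 / (k + 1)]
    that it contains. *)
Lemma open_Rd_measurable (D : set (d.-tuple R)) : open_Rd D -> measurable D.
Proof.
move=> oD.
pose c (q : d.-tuple rat) : d.-tuple R := [tuple ratr (tnth q i) | i < d].
(* [F p] is the ball coded by [p] if that ball lies in [D], and is empty otherwise. *)
pose F (p : d.-tuple rat * nat) : set (d.-tuple R) :=
  [set x | [/\ dist2 (c p.1) x < p.2.+1%:R^-1 &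
    (forall y, dist2 (c p.1) y < p.2.+1%:R^-1 -> D y)]].
have -> : D = \bigcup_p F p.
  apply/seteqP; split=> [x Dx|x [p _ [px pD]]]; last exact: pD.
  have [e e0 xe] := oD x Dx.
  (* With radius below [e / 2], a ball whose rational centre is within that radius of [x] stays
     within distance [e] of [x]. *)
  have [n ne] : exists n : nat, n.+1%:R^-1 < e / 2.
    have e20 : 0 < e / 2 by rewrite divr_gt0.
    have [n _ /(_ n (leqnn n)) nlt] := near_infty_natSinv_lt (PosNum e20).
    by exists n.
  have n0 : (0 : R) < n.+1%:R^-1 by rewrite invr_gt0 ltr0n.
  have /choice[q qx] : forall i, exists q : rat,
      `|ratr q - tnth x i| < n.+1%:R^-1 / d.+1%:R.
    move=> i; set dl := _ / _.
    have dl0 : 0 < dl by rewrite divr_gt0 ?ltr0n.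
    have [] := @rat_in_itvoo _ (tnth x i - dl) (tnth x i + dl).
      by rewrite ltrD2l gtrN.
    by move=> q; rewrite in_itv/= -ltr_distl => ?; exists q.
  have cx : dist2 (c [tuple q i | i < d]) x < n.+1%:R^-1.
    by apply: dist2_lt_coord => // i; rewrite !tnth_mktuple.
  exists ([tuple q i | i < d], n) => //; split=> //= y cy; apply: xe.
  apply: le_lt_trans (dist2_triangle (c [tuple q i | i < d]) _ _) _.
  by rewrite dist2C [ltRHS]splitr ltrD//; exact: lt_trans ne.
apply: countable_bigcupT_measurable => [|p].
  exact: countableP.
have [pD|npD] := pselect (forall y, dist2 (c p.1) y < p.2.+1%:R^-1 -> D y); last first.
  by rewrite (_ : F p = set0)//; apply/seteqP; split=> x // -[].
rewrite (_ : F p = setT `&` dist2 (c p.1) @^-1` `]-oo, p.2.+1%:R^-1[%classic).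
  by apply: measurable_dist2 => //; exact: measurable_itv.
apply/seteqP; split=> x /=; first by move=> []; rewrite in_itv/=.
by rewrite in_itv/= => -[].
Qed.

(** Nothing is known about [f] outside [D], so superlevel sets are used: for [a < 0] they are the
    whole space, and for [a >= 0] they are open because [D] is open and [f] is Lipschitz on it. *)
Lemma measurable_pos_part_on (D : set (d.-tuple R)) (f : d.-tuple R -> R) (L : R) :
  open_Rd D -> 0 < L ->
  (forall x y, D x -> D y -> `|f x - f y| <= L * dist2 x y) ->
  measurable_fun setT (fun t => \1_D t * Num.max (f t) 0).
Proof.
move=> oD L0 fL.
apply: (measurability _ (RGenOInfty.measurableE R)) => //.
move=> _ [_ [a ->] <-]; rewrite setTI.
have [a0|a0] := ltP a 0.
  rewrite (_ : _ @^-1` _ = setT)//; apply/seteqP; split=> x //= _.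
  rewrite in_itv/= andbT; apply: lt_le_trans a0 _.
  by rewrite mulr_ge0// le_max lexx orbT.
rewrite (_ : _ @^-1` _ = [set x | D x /\ a < f x]); last first.
  apply/seteqP; split=> x /=; rewrite in_itv/= andbT indicE.
    have [/set_mem Dx|] := boolP (x \in D); last by rewrite mul0r ltNge a0.
    by rewrite mul1r lt_max => /orP[//|]; rewrite ltNge a0.
  by move=> [Dx ax]; rewrite mem_set// mul1r lt_max ax.
apply: open_Rd_measurable => x [Dx ax].
have [e e0 xe] := oD x Dx.
have fa0 : 0 < (f x - a) / L by rewrite divr_gt0// subr_gt0.
exists (Num.min e ((f x - a) / L)); first by rewrite lt_min e0.
move=> y; rewrite lt_min => /andP[/xe Dy]; rewrite ltr_pdivlMr// mulrC => xy.
split=> //; have := le_lt_trans (fL x y Dx Dy) xy.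
by rewrite ltr_norml => /andP[_]; rewrite ltrD2l ltrN2.
Qed.

End EuclideanDistance.

(** * Real-valued integrands and finiteness of their integrals *)

Section RealIntegrands.
Context {R : realType} {d : nat}.
Implicit Types (g h : d.-tuple R -> R) (A D : set (d.-tuple R)).

Lemma le_iint_EFin g h :
  measurable_fun setT g -> measurable_fun setT h ->
  (forall t, 0 <= g t) -> (forall t, g t <= h t) ->
  (iint (fun t => (g t)%:E) <= iint (fun t => (h t)%:E))%E.
Proof.
move=> mg mh g0 gh; apply: le_iint => [||t|t]; rewrite ?lee_fin//.
  exact/measurable_EFinP.
exact/measurable_EFinP.
Qed.

Lemma iint_EFinD g h :
  measurable_fun setT g -> measurable_fun setT h ->
  (forall t, 0 <= g t) -> (forall t, 0 <= h t) ->
  iint (fun t => (g t + h t)%:E) =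
  (iint (fun t => (g t)%:E) + iint (fun t => (h t)%:E))%E.
Proof.
move=> mg mh g0 h0; rewrite -iintD//; first exact/measurable_EFinP.
exact/measurable_EFinP.
Qed.

Lemma iint_EFinZl (k : R) g :
  measurable_fun setT g -> (forall t, 0 <= g t) -> 0 <= k ->
  iint (fun t => (k * g t)%:E) = (k%:E * iint (fun t => (g t)%:E))%E.
Proof. by move=> mg g0 k0; rewrite -iintZl//; exact/measurable_EFinP. Qed.

Lemma iint_indicZl (k : R) A : measurable A -> 0 <= k ->
  iint (fun t => (k * \1_A t)%:E) = (k%:E * lebesgue_d A)%E.
Proof. by move=> mA k0; rewrite iint_EFinZl//; exact: measurable_indic. Qed.

Lemma measurable_dist2_lt (c : d.-tuple R) (r : R) :
  measurable [set x | dist2 c x < r].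
Proof.
rewrite (_ : [set x | _] = setT `&` dist2 c @^-1` `]-oo, r[%classic).
  by apply: measurable_dist2 => //; exact: measurable_itv.
by rewrite setTI; apply/seteqP; split=> x /=; rewrite in_itv.
Qed.

Lemma measurable_dist2_ge (c : d.-tuple R) (r : R) :
  measurable [set x | r <= dist2 x c].
Proof.
rewrite (_ : [set x | _] = ~` [set x | dist2 c x < r]).
  by apply: measurableC; exact: measurable_dist2_lt.
by apply/seteqP; split=> x /=; rewrite dist2C leNgt => /negP.
Qed.

(** The integrand is at most [\1_D], which has integral 1. Finiteness turns the difference in
    [integral_on] into a subtraction of real numbers. *)
Lemma iint_pos_part_fin D (f : d.-tuple R -> R) (L : R) :
  open_Rd D -> lebesgue_d D = 1%E -> 0 < L -> C0 D L f ->
  exists2 p : R, 0 <= p & iint (fun t => (\1_D t * Num.max (f t) 0)%:E) = p%:E.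
Proof.
move=> oD D1 L0 [f1 fL].
have P0 t : 0 <= \1_D t * Num.max (f t) 0 by rewrite mulr_ge0// le_max lexx orbT.
have I0 : (0 <= iint (fun t => (\1_D t * Num.max (f t) 0)%:E))%E.
  by apply: iint_ge0 => t; rewrite lee_fin.
have I1 : (iint (fun t => (\1_D t * Num.max (f t) 0)%:E) <= 1)%E.
  rewrite -D1; apply: le_iint_EFin => //.
  - exact: measurable_pos_part_on L0 fL.
  - by apply: measurable_indic; exact: open_Rd_measurable.
  move=> t; rewrite indicE; have [/set_mem Dt|_] := boolP (t \in D).
    rewrite mul1r ge_max ler01 andbT.
    exact: le_trans (ler_norm _) (f1 _ Dt).
  by rewrite mul0r.
move: I0 I1; case: (iint _) => [p||] // p0 _.
by exists p.
Qed.

End RealIntegrands.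

Lemma C0N (R : realType) (d : nat) (D : set (d.-tuple R)) (L : R) f :
  C0 D L f -> C0 D L (fun t => - f t).
Proof.
move=> [f1 fL]; split=> [x Dx|x y Dx Dy]; first by rewrite normrN f1.
by rewrite -opprD normrN fL.
Qed.

Lemma max0_subN (R : realType) (u : R) : Num.max u 0 - Num.max (- u) 0 = u.
Proof.
have [u0|u0] := leP u 0; first by rewrite max_l ?oppr_ge0// sub0r opprK.
by rewrite max_r ?subr0// oppr_le0 ltW.
Qed.

(** * Upper bound: the error of a single function value *)

Section OnePoint.
Context {R : realType} {d : nat}.
Variables (D : set (d.-tuple R)) (L : R) (xs : d.-tuple R) (rho eta m : R).
Hypotheses (oD : open_Rd D) (D1 : lebesgue_d D = 1%E) (L0 : 0 < L) (Dxs : D xs).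
Hypotheses (eta0 : 0 <= eta) (rho_eta : L * rho <= eta).
Hypothesis far_m : (lebesgue_d [set x | D x /\ (rho <= dist2 x xs)%R] <= m%:E)%E.

(** This is one side of the error estimate, with every term moved to where its sign is positive,
    since [iint] is additive for nonnegative functions only. *)
Lemma one_point_upper f : C0 D L f ->
  (iint (fun t => (\1_D t * Num.max (f t) 0)%:E) + (Num.max (- f xs) 0)%:E <=
   iint (fun t => (\1_D t * Num.max (- f t) 0)%:E) +
     (Num.max (f xs) 0 + eta + 2 * m)%:E)%E.
Proof.
move=> Cf; have [f1 fL] := Cf; have [_ NfL] := C0N Cf.
pose far := [set x | D x /\ rho <= dist2 x xs].
have mD := open_Rd_measurable oD.
have mfar : measurable far by apply: measurableI => //; exact: measurable_dist2_ge.
have miD : measurable_fun setT (\1_D : _ -> R) by exact: measurable_indic.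
have mif : measurable_fun setT (\1_far : _ -> R) by exact: measurable_indic.
set P := fun t => \1_D t * Num.max (f t) 0.
set M := fun t => \1_D t * Num.max (- f t) 0.
have mP : measurable_fun setT P by exact: measurable_pos_part_on L0 fL.
have mM : measurable_fun setT M by exact: measurable_pos_part_on L0 NfL.
have P0 t : 0 <= P t by rewrite mulr_ge0// le_max lexx orbT.
have M0 t : 0 <= M t by rewrite mulr_ge0// le_max lexx orbT.
set a := Num.max (f xs) 0; set b := Num.max (- f xs) 0.
have a0 : 0 <= a by rewrite le_max lexx orbT.
have b0 : 0 <= b by rewrite le_max lexx orbT.
have ae0 : 0 <= a + eta by rewrite addr_ge0.
have mk (k : R) (h : d.-tuple R -> R) : measurable_fun setT h ->
    measurable_fun setT (fun t => k * h t) by move=> mh; exact: measurable_funM.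
have : (iint (fun t => (P t + b * \1_D t)%:E) <=
  iint (fun t => ((M t + (a + eta) * \1_D t) + 2 * \1_far t)%:E))%E.
  apply: le_iint_EFin.
  - by apply: measurable_funD => //; exact: mk.
  - apply: measurable_funD; last exact: mk.
    by apply: measurable_funD => //; exact: mk.
  - by move=> t; rewrite addr_ge0// mulr_ge0.
  - move=> t; rewrite /P /M !indicE.
    have [/set_mem Dt|tD] := boolP (t \in D); last first.
      by rewrite !mul0r !mulr0 !add0r mulr_ge0.
    rewrite !mul1r !mulr1.
    have ft := max0_subN (f t); have fx : a - b = f xs := max0_subN (f xs).
    (* Writing [f t] and [f xs] as differences of positive and negative parts leaves this bound:
       near [xs] the Lipschitz condition gives [eta], and far away [|f| <= 1] gives 2. *)
    suff : f t <= f xs + eta + 2 * (t \in far)%:R.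
      by move: (Num.max (f t) 0) (Num.max (- f t) 0) ft => u v; lra.
    have [/set_mem _|tf] := boolP (t \in far).
      have := f1 _ Dt; have := f1 _ Dxs; rewrite /= mulr1n mulr1.
      by rewrite !ler_norml => /andP[? ?] /andP[? ?]; move: eta0; lra.
    rewrite mulr0n mulr0 addr0.
    have tr : dist2 t xs < rho.
      by rewrite ltNge; apply: contra tf => tr; exact/mem_set.
    have := fL _ _ Dt Dxs; rewrite ler_norml => /andP[_].
    have : L * dist2 t xs <= eta.
      by apply: le_trans rho_eta; rewrite ler_pM2l// ltW.
    by lra.
have Zge0 (k : R) A t : 0 <= k -> 0 <= k * (\1_A t : R).
  by move=> k0; rewrite mulr_ge0.
rewrite !iint_EFinD//; try by [exact: mk | move=> t; exact: Zge0]; last 2 first.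
- by apply: measurable_funD => //; exact: mk.
- by move=> t; rewrite addr_ge0// Zge0.
rewrite !iint_indicZl// D1 !mule1 => /le_trans; apply.
rewrite -addeA leeD2l// [in leRHS]EFinD leeD2l// EFinM.
by rewrite lee_pmul2l.
Qed.

(** The one-sided estimate, applied to [f] and to [- f], bounds the error from both sides. *)
Lemma one_point_error f : C0 D L f ->
  (`|integral_on D f - (f xs)%:E| <= (eta + 2 * m)%:E)%E.
Proof.
move=> Cf; have CN := C0N Cf.
have up := one_point_upper Cf; have dn := one_point_upper CN.
have eqN : (fun t => (\1_D t * Num.max (- - f t) 0)%:E) =
    (fun t => (\1_D t * Num.max (f t) 0)%:E).
  by apply/funext => t; rewrite opprK.
rewrite eqN opprK in dn; rewrite /integral_on.
have [p p0 pE] := iint_pos_part_fin oD D1 L0 Cf.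
have [q q0 qE] := iint_pos_part_fin oD D1 L0 CN.
rewrite pE qE !lee_fin in up dn *.
have := max0_subN (f xs).
move: up dn; move: (Num.max (f xs) 0) (Num.max (- f xs) 0) => u v up dn uv.
by rewrite ler_norml; apply/andP; split; lra.
Qed.

End OnePoint.

(* Chernoff bound: on the ball the product of the scaled Gaussian densities
   [exp(1/2) * exp(- (x_i - c_i)^2 / (2 r^2))] is at least 1, and [r] is chosen
   so that each factor has integral 1/2. *)
Lemma ball_volume (R : realType) : exists2 r : R, 0 < r &
  forall (d : nat) (c : d.-tuple R),
    (lebesgue_d [set x | (dist2 c x < r * Num.sqrt d%:R)%R] <= (2^-1 ^+ d)%:E)%E.
Proof.
have pi2 : 0 < Num.sqrt (pi *+ 2 : R).
  by rewrite sqrtr_gt0 mulrn_wgt0// pi_gt0.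
have e0 : 0 < expR (2^-1 : R) by exact: expR_gt0.
pose r : R := (2 * expR 2^-1 * Num.sqrt (pi *+ 2))^-1.
have r0 : 0 < r by rewrite invr_gt0 !mulr_gt0.
have rn0 : r != 0 by rewrite gt_eqF.
(* This value makes half the normal density equal to [exp(1/2 - (x - c_i)^2 / (2 r^2))]. *)
have peak : normal_peak r = 2 * expR 2^-1.
  rewrite /normal_peak -mulrnAr sqrtrM ?sqr_ge0// sqrtr_sqr gtr0_norm//.
  by rewrite /r; field; rewrite !gt_eqF.
exists r => // d c.
pose g i x := 2^-1 * normal_pdf (tnth c i) r x.
have mg i : measurable_fun setT (g i).
  by apply: measurable_funM => //; exact: measurable_normal_pdf.
have g0 i x : 0 <= g i x by rewrite mulr_ge0// normal_pdf_ge0.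
have <- : iint (fun t : d.-tuple R => (\prod_(i < d) g i (tnth t i))%:E) =
    (2^-1 ^+ d)%:E.
  rewrite iint_prod// (eq_bigr (fun=> (2^-1 : R)%:E)).
    by rewrite prodEFin prodr_const card_ord.
  move=> i _; rewrite /g; under eq_integral do rewrite EFinM.
  rewrite ge0_integralZl_EFin//.
  - by rewrite integral_normal_pdf mule1.
  - by move=> x _; rewrite lee_fin normal_pdf_ge0.
  - by apply/measurable_EFinP; exact: measurable_normal_pdf.
apply: le_iint_EFin => //.
- by apply: measurable_indic; exact: measurable_dist2_lt.
- apply: measurable_prod => i _.
  exact: measurableT_comp (mg _) (measurable_tnth _).
move=> t; rewrite indicE; have [/set_mem/= ct|_] := boolP (_ \in _); last first.
  by rewrite prodr_ge0.
have -> : \prod_(i < d) g i (tnth t i) =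
    expR (\sum_(i < d) (2^-1 - (tnth c i - tnth t i) ^+ 2 / (r ^+ 2 *+ 2))).
  rewrite expR_sum; apply: eq_bigr => i _.
  rewrite /g normal_pdfE// peak /normal_fun expRD -[(_ - tnth c i) ^+ 2]sqrrN opprB.
  by rewrite !mulrA mulVf// mul1r mulNr.
(* The exponent is [d / 2 - dist2 c t ^+ 2 / (2 r^2)], which is nonnegative when
   [dist2 c t <= r * sqrt d]. *)
rewrite -[X in X <= _]expR0 ler_expR sumrB -mulr_suml -sqr_dist2 sumr_const card_ord.
rewrite subr_ge0 ler_pdivrMr ?mulrn_wgt0 ?exprn_gt0//.
have -> : (2^-1 *+ d : R) * (r ^+ 2 *+ 2) = (r * Num.sqrt d%:R) ^+ 2.
  rewrite exprMn sqr_sqrtr ?ler0n// -[2^-1 *+ d]mulr_natr -[r ^+ 2 *+ 2]mulr_natr.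
  by field.
by rewrite ler_pXn2r ?nnegrE ?dist2_ge0 ?mulr_ge0 ?(ltW r0) ?(ltW ct).
Qed.

(** * Lower bound: adaptive information and the fooling function *)

Lemma info_nseq0 (R : realType) (d : nat) (p : nat -> seq R -> d.-tuple R) f k :
  (forall j, (j < k)%N -> f (p j (nseq j 0)) = 0) -> info p f k = nseq k 0.
Proof.
elim: k => [//|k IH] pf /=.
rewrite IH; last by move=> j jk; apply: pf; exact: ltnW.
by rewrite pf// -cats1 -[[:: 0]]/(nseq 1 0) -nseqD addn1.
Qed.

Section FoolingFunction.
Context {R : realType} {d : nat}.
Variables (D : set (d.-tuple R)) (L : R) (A : algorithm R d).
Hypothesis L0 : 0 < L.

(** These are the queries made as long as every value seen so far is 0. By [info_nseq0], a function
    vanishing at them yields only zeros, so adaptivity does not help. *)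
Let node (j : 'I_(nvals A)) := pt A j (nseq j 0).

(** The initial value 1 of the minimum supplies the bound on the sup norm and covers algorithms
    without any query. *)
Definition fooling (x : d.-tuple R) : R :=
  \big[Num.min/1]_(j < nvals A) (L * dist2 (node j) x).

Lemma fooling_ge0 x : 0 <= fooling x.
Proof. by apply/bigmin_geP; split=> // j _; rewrite mulr_ge0 ?dist2_ge0 ?ltW. Qed.

Lemma fooling_le1 x : fooling x <= 1.
Proof. exact: bigmin_le_id. Qed.

Lemma fooling_node j : fooling (node j) = 0.
Proof.
apply/eqP; rewrite eq_le fooling_ge0 andbT.
by apply: le_trans (bigmin_le _ j _) _; rewrite dist2xx mulr0.
Qed.

(** By the triangle inequality each [L * dist2 (node j)] is Lipschitz with constant [L], and this
    passes to the minimum. *)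
Lemma fooling_C0 : C0 D L fooling.
Proof.
have le x y : fooling x - fooling y <= L * dist2 x y.
  rewrite lerBlDl -lerBlDr; apply/bigmin_geP; split=> [|j _].
    rewrite lerBlDr; apply: le_trans (fooling_le1 x) _.
    by rewrite lerDl mulr_ge0 ?dist2_ge0 ?ltW.
  rewrite lerBlDr -mulrDr; apply: le_trans (bigmin_le _ j _) _.
  by rewrite ler_pM2l// (dist2C x) dist2_triangle.
split=> [x _|x y _ _]; first by rewrite ger0_norm ?fooling_ge0 ?fooling_le1.
by rewrite ler_norml le andbT lerNl opprB dist2C le.
Qed.

(** Used for [s = 1] and [s = -1]: the algorithm cannot tell the two signs apart. *)
Lemma run_fooling (s : R) : run A (fun t => s * fooling t) = phi A (nseq (nvals A) 0).
Proof.
rewrite /run info_nseq0// => j jn.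
by have := fooling_node (Ordinal jn) => /= ->; rewrite mulr0.
Qed.

Lemma fooling_lower_bound (rho kappa eps v : R) :
  open_Rd D -> lebesgue_d D = 1%E ->
  (forall c : d.-tuple R, lebesgue_d [set x | (dist2 c x < rho)%R] <= v%:E)%E ->
  0 <= kappa <= 1 -> kappa <= L * rho ->
  (wc_error D (C0 D L) A <= eps%:E)%E ->
  kappa <= eps + kappa * ((nvals A)%:R * v).
Proof.
move=> oD D1 vol /andP[k0 k1] kL err.
have Cf := fooling_C0; have Cg := C0N Cf.
have [_ fL] := Cf.
have errP f : C0 D L f -> (`|integral_on D f - (run A f)%:E| <= eps%:E)%E.
  by move=> CLf; apply: le_trans err; apply: ereal_sup_ubound; exists f.
have [p p0 pE] := iint_pos_part_fin oD D1 L0 Cf.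
have N0 : iint (fun t : d.-tuple R => (\1_D t * Num.max (- fooling t) 0)%:E) = 0%E.
  rewrite -[RHS](@iint0 R d); congr iint; apply/funext => t.
  by rewrite max_r ?mulr0// oppr_le0 fooling_ge0.
(* Both [p] and [- p] are within [eps] of the common output of the algorithm. *)
have pe : p <= eps.
  have := errP _ Cf; have := errP _ Cg; rewrite /integral_on pE N0.
  under eq_fun do rewrite opprK.
  rewrite pE.
  have -> : run A fooling = phi A (nseq (nvals A) 0).
    by rewrite -(run_fooling 1); congr run; apply/funext => t; rewrite mul1r.
  have -> : run A (fun t => - fooling t) = phi A (nseq (nvals A) 0).
    by rewrite -(run_fooling (-1)); congr run; apply/funext => t; rewrite mulN1r.
  move: (phi A _) => a; rewrite !lee_fin !ler_norml => /andP[? ?] /andP[? ?].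
  by lra.
pose B j := [set x | dist2 (node j) x < rho].
have mB j : measurable (B j) by exact: measurable_dist2_lt.
have mD := open_Rd_measurable oD.
have mS : measurable_fun setT (fun t => \sum_(j < nvals A) (\1_(B j) t : R)).
  by apply: measurable_sum => j; exact: measurable_indic.
have mP := measurable_pos_part_on oD L0 fL.
(* Integrate over [D] the pointwise bound [kappa <= fooling + kappa * \sum_j \1_(B j)]: outside all
   balls [fooling] is at least [kappa], and inside a ball the sum is at least 1. *)
have : (kappa%:E <= p%:E + kappa%:E * \sum_(j < nvals A) lebesgue_d (B j))%E.
  rewrite -[leLHS]mule1 -D1 -iint_indicZl// -iint_sum; last 2 first.
  - by move=> j; exact: measurable_indic.
  - by move=> j t.
  rewrite -iint_EFinZl//; last by move=> t; exact: sumr_ge0.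
  rewrite -pE -iint_EFinD//; last 3 first.
  - exact: measurable_funM.
  - by move=> t; rewrite mulr_ge0// le_max lexx orbT.
  - by move=> t; rewrite mulr_ge0// sumr_ge0.
  apply: le_iint_EFin.
  - by apply: measurable_funM => //; exact: measurable_indic.
  - by apply: measurable_funD => //; exact: measurable_funM.
  - by move=> t; rewrite mulr_ge0.
  move=> t; rewrite max_l ?fooling_ge0// [\1_D t]indicE.
  have [Dt|_] := boolP (t \in D); last by rewrite mulr0 mul0r add0r mulr_ge0// sumr_ge0.
  rewrite mulr1 mul1r.
  have [[j tB]|ntB] := pselect (exists j, B j t).
    rewrite (bigD1 j)//= indicE mem_set// mulrDr mulr1.
    by rewrite addrCA lerDl addr_ge0 ?fooling_ge0// mulr_ge0// sumr_ge0//.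
  rewrite -[leLHS]addr0 lerD//; last by rewrite mulr_ge0// sumr_ge0.
  apply/bigmin_geP; split=> // j _; apply: le_trans kL _.
  by rewrite ler_pM2l// leNgt; apply/negP => tB; apply: ntB; exists j.
have sumv : (\sum_(j < nvals A) lebesgue_d (B j) <= ((nvals A)%:R * v)%:E)%E.
  rewrite (_ : _%:E = \sum_(j < nvals A) v%:E)%E; first by apply: lee_sum => j _; exact: vol.
  by rewrite sumEFin sumr_const card_ord mulr_natl.
have k0E : (0 <= kappa%:E)%E by rewrite lee_fin.
move=> /le_trans /(_ (leeD2l p%:E (lee_wpmul2l k0E sumv))).
by rewrite -EFinM -EFinD lee_fin => /le_trans; apply; rewrite lerD2r.
Qed.

End FoolingFunction.

(** * The two implications of the equivalence *)

Lemma curse_sufficient (R : realType) (D : forall d : nat, set (d.-tuple R))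
  (L : nat -> R) :
  property_P D -> (forall d, 0 < L d) ->
  (0 < limn_esup (fun d : nat => (L d * Num.sqrt d%:R)%:E))%E ->
  curse D (fun d => C0 (D d) (L d)).
Proof.
move=> [oD [D1 _]] L0 limL.
have [r r0 vol] := ball_volume R.
have [dl dl0 dlL] : exists2 dl : R, 0 < dl &
    (dl%:E < limn_esup (fun d : nat => (L d * Num.sqrt d%:R)%:E))%E.
  (* The limsup may be infinite, in which case any positive [dl] will do. *)
  move: limL; case: (limn_esup _) => [l|_|//]; last by exists 1; rewrite ?ltry.
  rewrite lte_fin => l0; exists (l / 2); first by rewrite divr_gt0.
  by rewrite lte_fin ltr_pdivrMr// mulr_natr mulr2n ltrDl.
pose kappa := Num.min 1 (dl * r).
have k0 : 0 < kappa by rewrite lt_min ltr01 mulr_gt0.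
(* For [eps <= kappa / 2] the fooling bound reads [kappa / 2 <= kappa * n * 2^-d], that is
   [n >= 2^d / 2]. *)
exists 2^-1, (kappa / 2), 1; split=> //; first by rewrite divr_gt0.
move=> N.
(* The supremum over each tail is at least the limsup, so it exceeds [dl]. *)
have [_ [d /= Nd <-] dlLd] : exists2 y,
    [set (L d * Num.sqrt d%:R)%:E | d in [set d | (N <= d)%N]] y & (dl%:E < y)%E.
  apply: ereal_sup_gt; apply: lt_le_trans dlL _; apply: ereal_inf_lbound.
  by exists [set d | (N <= d)%N] => //; exists N.
exists d => // eps epsk; apply: le_ereal_inf_tmp => _ [A [_ err] <-].
rewrite lee_fin.
have kL : kappa <= L d * (r * Num.sqrt d%:R).
  rewrite ge_min; apply/orP; right; rewrite mulrCA mulrC ler_pM2l//.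
  by apply: ltW; rewrite -lte_fin.
have k01 : 0 <= kappa <= 1 by rewrite ltW// ge_min lexx.
have le := fooling_lower_bound (L0 d) (oD d) (D1 d) (vol d) k01 kL err.
have : kappa * 2^-1 <= kappa * ((nvals A)%:R * 2^-1 ^+ d).
  by move: (kappa * (_ * _)) le => u; lra.
by rewrite ler_pM2l// exprVn ler_pdivlMr ?exprn_gt0// -natr1.
Qed.

Lemma curse_necessary (R : realType) (D : forall d : nat, set (d.-tuple R))
  (L : nat -> R) :
  property_P D -> (forall d, 0 < L d) ->
  curse D (fun d => C0 (D d) (L d)) ->
  (0 < limn_esup (fun d : nat => (L d * Num.sqrt d%:R)%:E))%E.
Proof.
move=> [oD [D1 [xs [rad [Dxs far0]]]]] L0 [c [eps [gamma [c0 eps0 gamma0 cu]]]].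
rewrite ltNge; apply/negP => limL.
(* Chosen so that [|rad| * dl <= eps / 2]; the absolute value and the added 1 allow for [rad] being
   negative or 0. *)
pose dl := eps / 2 / (`|rad| + 1).
have rad1 : 0 < `|rad| + 1 by rewrite ltr_wpDl.
have dl0 : 0 < dl by rewrite !divr_gt0.
have : (limn_esup (fun d : nat => (L d * Num.sqrt d%:R)%:E) < dl%:E)%E.
  by apply: le_lt_trans limL _; rewrite lte_fin.
move=> /ereal_inf_lt[_ [V [N1 _ VN1] <-] supV].
have [fin_far cvg_far] := (fine_cvgP _ _).1 far0.
have eps4 : 0 < eps / 4 by rewrite divr_gt0.
have [N2 _ far_fin] := fin_far.
have [N3 _ far_small] := cvgr_lt _ cvg_far _ eps4.
(* The powers of [(1 + gamma)^-1] tend to 0, so [c * (1 + gamma) ^+ d] eventually exceeds 1, the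
   cost of the algorithm built below. *)
have g1 : `|(1 + gamma)^-1| < 1.
  by rewrite gtr0_norm ?invr_gt0 ?addr_gt0// invf_lt1 ?addr_gt0// ltrDl.
have [N4 _ geo] := cvgr_lt _ (cvg_geometric 1 g1) _ c0.
have [d Nd cud] := cu (maxn (maxn N1 N2) (maxn N3 N4)).
move: Nd; rewrite !geq_max => /andP[/andP[d1 d2] /andP[d3 d4]].
have := cud eps (lexx _); apply/negP; rewrite -ltNge.
have c1 : 1 < c * (1 + gamma) ^+ d.
  have := geo d d4; rewrite /= mul1r exprVn.
  by rewrite -[_^-1]mul1r ltr_pdivrMr ?exprn_gt0 ?addr_gt0.
apply: (@le_lt_trans _ _ 1%E); last by rewrite lte_fin.
apply: ereal_inf_lbound.
(* The algorithm returns its only value [f (xs d)]; the default 0 of [head] never occurs, as the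
   list has length 1. *)
exists (Algorithm 1 (fun _ _ => xs d) (head 0)) => //; split=> [j s|]; first exact: Dxs.
apply: ge_ereal_sup => _ [f Cf <-].
have Ldl : L d * Num.sqrt d%:R < dl.
  by rewrite -lte_fin; apply: le_lt_trans supV; apply: ereal_sup_ubound; exists d => //; exact: VN1.
have rhoL : L d * (rad * Num.sqrt d%:R) <= eps / 2.
  rewrite mulrCA; apply: le_trans (ler_norm _) _.
  rewrite normrM (ger0_norm (mulr_ge0 (ltW (L0 d)) (sqrtr_ge0 _))).
  have : `|rad| * (L d * Num.sqrt d%:R) <= `|rad| * dl by rewrite ler_wpM2l// ltW.
  move=> /le_trans; apply; rewrite /dl mulrCA ler_piMr ?divr_ge0 ?(ltW eps0)//.
  by rewrite ler_pdivrMr// mul1r lerDl.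
have farm : (lebesgue_d [set x | D d x /\ (rad * Num.sqrt d%:R <= dist2 x (xs d))%R]
    <= (eps / 4)%:E)%E.
  rewrite -(fineK (far_fin d d2)) lee_fin; apply: ltW.
  exact: far_small d d3.
have e2 : 0 <= eps / 2 by rewrite divr_ge0// ltW.
have := one_point_error (oD d) (D1 d) (L0 d) (Dxs d) e2 rhoL farm Cf.
(* Half of [eps] pays for the variation near [xs d], the other half for the far part, of volume at
   most [eps / 4] and deviation at most 2. *)
by rewrite (_ : eps / 2 + 2 * (eps / 4) = eps)//; field.
Qed.

Unset Implicit Arguments. Set Strict Implicit.

Theorem theorem3p1 (R : realType) (D : forall d : nat, set (d.-tuple R))
  (L : nat -> R) :
  property_P D -> (forall d, 0 < L d) ->
  (curse D (fun d => C0 (D d) (L d)) <->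
   (0 < limn_esup (fun d : nat => (L d * Num.sqrt d%:R)%:E))%E).
Proof.
by move=> PD L0; split; [exact: curse_necessary|exact: curse_sufficient].
Qed.
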